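(* Let $(X,\mathcal T)$ be a topological space. The following are equivalent: (1) $(X,\mathcal T)$ satisfies the classical topological Katětov–Tong interpolation theorem for bounded (positive) real-valued maps: for all bounded functions $g,h:X\to[0,\infty[$ with $g\le h$, $g$ upper semicontinuous and $h$ lower semicontinuous, there exists a continuous $f:X\to[0,\infty[$ with $g\le f\le h$; (2) the approach space $(X,\delta_{\mathcal T})$ satisfies Katětov–Tong's interpolation in the approach sense defined in the context.
   Context: A distance on a set $X$ is a function $\delta:X\times 2^X\to[0,\infty]$ such that for all $x\in X$, $A,B\subseteq X$, $\varepsilon\in[0,\infty]$: (D1) $\delta(x,\{x\})=0$; (D2) $\delta(x,\emptyset)=\infty$; (D3) $\delta(x,A\cup B)=\min\{\delta(x,A),\delta(x,B)\}$; (D4) $\delta(x,A)\le\delta(x,A^{(\varepsilon)})+\varepsilon$, where $A^{(\varepsilon)}=\{x\in X\mid\delta(x,A)\le\varepsilon\}$. The pair $(X,\delta)$ is an approach space. A map $f:(X,\delta_X)\to(Y,\delta_Y)$ is a contraction if $\delta_Y(f(x),f(A))\le\delta_X(x,A)$ for all $x\in X$, $A\subseteq X$. For a topology $\mathcal T$ on $X$, the associated distance is $\delta_{\mathcal T}(x,A)=0$ if $x\in\mathrm{cl}\,A$ and $\infty$ otherwise. For $d:Z\times Z\to[0,\infty]$ vanishing on the diagonal and satisfying the triangle inequality, $\delta_d(z,A)=\inf_{a\in A}d(z,a)$. Write $x\ominus y=(x-y)\vee0$ on $[0,\infty]$ (with $\infty\ominus\infty=0$), $d_{\mathbb P}(x,y)=x\ominus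 y$, $d_{\mathbb P}^-(x,y)=y\ominus x$, $d_{\mathbb E}=d_{\mathbb P}\vee d_{\mathbb P}^-$ (the Euclidean metric, extended to $[0,\infty]$). On $[0,\infty]$ let $\delta_{\mathbb P}(x,A)=x\ominus\sup A$ for $A\ne\emptyset$ and $\delta_{\mathbb P}(x,\emptyset)=\infty$. A function $X\to[0,\infty]$ is lower regular if it is a contraction $(X,\delta)\to([0,\infty],\delta_{\mathbb P})$; it is upper regular if it is bounded and a contraction $(X,\delta)\to([0,\infty],\delta_{d_{\mathbb P}^-})$. Katětov–Tong's interpolation in the approach sense: for all bounded functions $g,h:X\to[0,\infty]$ with $g\le h$, $g$ upper regular and $h$ lower regular, there exists a contraction $f:(X,\delta)\to([0,\infty],\delta_{d_{\mathbb E}})$ with $g\le f\le h$. *)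

(* Defs.v *)
From HB Require Import structures.
From mathcomp Require Import all_boot all_order all_algebra.
From mathcomp Require Import all_classical all_reals all_analysis.

Set Implicit Arguments.
Unset Strict Implicit.
Unset Printing Implicit Defensive.

Import Order.TTheory GRing.Theory Num.Theory.
Import numFieldNormedType.Exports.

Local Open Scope classical_set_scope.
Local Open Scope ring_scope.
Local Open Scope ereal_scope.

(** The interval [0, +oo] is the library type {nonneg \bar R}, which does
    contain +oo; the underlying extended real of x is x%:num. *)

Record distance (R : realType) (X : Type) := Distance {
  dist :> X -> set X -> \bar R ;
  dist_ge0 : forall x A, 0 <= dist x A ;
  dist_set1 : forall x, dist x [set x] = 0 ;
  dist_set0 : forall x, dist x set0 = +oo ;
  dist_setU : forall x A B, dist x (A `|` B) = mine (dist x A) (dist x B) ;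
  dist_enlarge : forall x A e, 0 <= e ->
    dist x A <= dist x [set y | dist y A <= e] + e
}.

Definition approach_contraction (R : realType) (X Y : Type)
    (dX : distance R X) (dY : distance R Y) (f : X -> Y) : Prop :=
  forall x A, dY (f x) (f @` A) <= dX x A.

Lemma ge0_addey (R : realType) (x : \bar R) : 0 <= x -> x + +oo = +oo.
Proof. by case: x. Qed.

(** ** The distance of a topology *)

Definition top_dist_fun (R : realType) (X : topologicalType)
    (x : X) (A : set X) : \bar R :=
  if x \in closure A then 0 else +oo.

Lemma top_dist_ge0 (R : realType) (X : topologicalType) (x : X) (A : set X) :
  0 <= top_dist_fun R x A.
Proof. by rewrite /top_dist_fun; case: ifP. Qed.

Lemma top_dist_set1 (R : realType) (X : topologicalType) (x : X) :
  top_dist_fun R x [set x] = 0.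
Proof. by rewrite /top_dist_fun mem_set//; exact: subset_closure. Qed.

Lemma top_dist_set0 (R : realType) (X : topologicalType) (x : X) :
  top_dist_fun R x set0 = +oo.
Proof. by rewrite /top_dist_fun closure0 in_set0. Qed.

Lemma top_dist_setU (R : realType) (X : topologicalType) (x : X)
    (A B : set X) :
  top_dist_fun R x (A `|` B) = mine (top_dist_fun R x A) (top_dist_fun R x B).
Proof.
rewrite /top_dist_fun closureU in_setU.
by case: ifP; case: (x \in closure A); case: (x \in closure B) => //= _;
  rewrite ?minxx ?miney ?minye.
Qed.

Lemma top_dist_enlarge (R : realType) (X : topologicalType) (x : X)
    (A : set X) (e : \bar R) : 0 <= e ->
  top_dist_fun R x A
    <= top_dist_fun R x [set y | top_dist_fun R y A <= e] + e.
Proof.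
move=> e0; rewrite {2}/top_dist_fun; case: ifPn => [|_]; last first.
  by rewrite addeC ge0_addey ?leey.
rewrite add0e inE; case: e e0 => [r| |]// r0; last by rewrite leey.
have -> : [set y | top_dist_fun R y A <= r%:E] = closure A.
  apply/seteqP; split=> y /=; rewrite /top_dist_fun.
    by case: ifPn; rewrite ?inE// leye_eq.
  by move=> yA; rewrite mem_set.
rewrite -((closure_id _).1 (@closed_closure _ A)) => xA.
by rewrite /top_dist_fun mem_set ?add0e.
Qed.

Definition top_dist (R : realType) (X : topologicalType) : distance R X :=
  Distance (@top_dist_ge0 R X) (@top_dist_set1 R X) (@top_dist_set0 R X)
    (@top_dist_setU R X) (@top_dist_enlarge R X).

(** ** The distance of a (non-symmetric, extended) metric *)

Record qmetric (R : realType) (Z : Type) := QMetric {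
  qmet :> Z -> Z -> \bar R ;
  qmet_ge0 : forall x y, 0 <= qmet x y ;
  qmet_refl : forall x, qmet x x = 0 ;
  qmet_triangle : forall x y z, qmet x z <= qmet x y + qmet y z
}.

Definition qmet_dist_fun (R : realType) (Z : Type) (d : qmetric R Z)
    (z : Z) (A : set Z) : \bar R :=
  ereal_inf [set d z a | a in A].

Lemma qmet_dist_ge0 (R : realType) (Z : Type) (d : qmetric R Z)
    (z : Z) (A : set Z) :
  0 <= qmet_dist_fun d z A.
Proof. by apply: le_ereal_inf_tmp => _ [a _ <-]; exact: qmet_ge0. Qed.

Lemma qmet_dist_set1 (R : realType) (Z : Type) (d : qmetric R Z) (z : Z) :
  qmet_dist_fun d z [set z] = 0.
Proof. by rewrite /qmet_dist_fun image_set1 ereal_inf1 qmet_refl. Qed.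

Lemma qmet_dist_set0 (R : realType) (Z : Type) (d : qmetric R Z) (z : Z) :
  qmet_dist_fun d z set0 = +oo.
Proof. by rewrite /qmet_dist_fun image_set0 ereal_inf0. Qed.

Lemma qmet_dist_setU (R : realType) (Z : Type) (d : qmetric R Z) (z : Z)
    (A B : set Z) :
  qmet_dist_fun d z (A `|` B)
    = mine (qmet_dist_fun d z A) (qmet_dist_fun d z B).
Proof.
apply/eqP; rewrite eq_le; apply/andP; split.
  rewrite le_min; apply/andP; split; apply: ereal_inf_le_tmp.
    by move=> _ [a Aa <-]; exists a => //; left.
  by move=> _ [a Ba <-]; exists a => //; right.
apply: le_ereal_inf_tmp => _ [a [aA|aB] <-]; rewrite ge_min; apply/orP.
  by left; apply: ereal_inf_lbound; exists a.
by right; apply: ereal_inf_lbound; exists a.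
Qed.

Lemma qmet_dist_enlarge (R : realType) (Z : Type) (d : qmetric R Z) (z : Z)
    (A : set Z) (e : \bar R) : 0 <= e ->
  qmet_dist_fun d z A
    <= qmet_dist_fun d z [set y | qmet_dist_fun d y A <= e] + e.
Proof.
case: e => [r r0|_|//]; last by rewrite ge0_addey ?leey// ?qmet_dist_ge0.
rewrite -leeBlDr//; apply: le_ereal_inf_tmp => _ [y /= yA <-].
have leD u v : u <= v + r%:E -> u - r%:E <= v by rewrite leeBlDr.
apply: leD; apply/lee_addgt0Pr => t t0.
have : qmet_dist_fun d y A < r%:E + t%:E.
  by rewrite (le_lt_trans yA)// -EFinD lte_fin ltrDl.
move=> /ereal_inf_lt[_ [a Aa <-]] /ltW yat.
apply: (@le_trans _ _ (d z a)); first by apply: ereal_inf_lbound; exists a.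
by rewrite -addeA (le_trans (qmet_triangle d z y a))// leeD2l.
Qed.

Definition qmet_dist (R : realType) (Z : Type) (d : qmetric R Z) :
    distance R Z :=
  Distance (qmet_dist_ge0 d) (qmet_dist_set1 d) (qmet_dist_set0 d)
    (qmet_dist_setU d) (qmet_dist_enlarge d).

(** ** Distances on [0, +oo] *)

(** Since +oo - +oo = -oo in \bar R, tsub +oo +oo = 0. *)
Definition tsub (R : realType) (x y : \bar R) : \bar R := maxe (x - y) 0.

Lemma tsub_ge0 (R : realType) (x y : \bar R) : 0 <= tsub x y.
Proof. by rewrite /tsub le_max lexx orbT. Qed.

Lemma tsub_le (R : realType) (x y e : \bar R) : 0 <= x -> 0 <= y -> 0 <= e ->
  (tsub x y <= e) = (x <= y + e).
Proof.
rewrite /tsub ge_max => x0 y0 e0; rewrite e0 andbT.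
case: y y0 => [y| |]// y0; first by rewrite leeBlDl.
rewrite [+oo + e]addeC ge0_addey// leey.
by case: x x0 => [x| |]// _ /=; rewrite ?leNye.
Qed.

Lemma tsub_refl (R : realType) (x : \bar R) : 0 <= x -> tsub x x = 0.
Proof.
move=> x0; apply/eqP; rewrite eq_le tsub_ge0 andbT.
by rewrite tsub_le// adde0.
Qed.

Lemma le_tsub (R : realType) (x y : \bar R) : 0 <= x -> 0 <= y ->
  x <= y + tsub x y.
Proof. by move=> x0 y0; rewrite -tsub_le ?tsub_ge0. Qed.

Lemma tsub_triangle (R : realType) (x y z : \bar R) :
  0 <= x -> 0 <= y -> 0 <= z -> tsub x z <= tsub x y + tsub y z.
Proof.
move=> x0 y0 z0; rewrite tsub_le ?adde_ge0 ?tsub_ge0//.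
rewrite (le_trans (le_tsub x0 y0))// [leRHS]addeCA [leLHS]addeC leeD2l//.
exact: le_tsub.
Qed.

Definition dP_fun (R : realType) (x y : {nonneg \bar R}) : \bar R :=
  tsub x%:num y%:num.

Definition dPm_fun (R : realType) (x y : {nonneg \bar R}) : \bar R :=
  tsub y%:num x%:num.

Definition dE_fun (R : realType) (x y : {nonneg \bar R}) : \bar R :=
  maxe (dP_fun x y) (dPm_fun x y).

Lemma dPm_ge0 (R : realType) (x y : {nonneg \bar R}) : 0 <= dPm_fun x y.
Proof. exact: tsub_ge0. Qed.

Lemma dPm_refl (R : realType) (x : {nonneg \bar R}) : dPm_fun x x = 0.
Proof. exact: tsub_refl. Qed.

Lemma dPm_triangle (R : realType) (x y z : {nonneg \bar R}) :
  dPm_fun x z <= dPm_fun x y + dPm_fun y z.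
Proof. by rewrite addeC; exact: tsub_triangle. Qed.

Definition dPm (R : realType) : qmetric R {nonneg \bar R} :=
  QMetric (@dPm_ge0 R) (@dPm_refl R) (@dPm_triangle R).

Lemma dE_ge0 (R : realType) (x y : {nonneg \bar R}) : 0 <= dE_fun x y.
Proof. by rewrite le_max tsub_ge0. Qed.

Lemma dE_refl (R : realType) (x : {nonneg \bar R}) : dE_fun x x = 0.
Proof. by rewrite /dE_fun /dP_fun dPm_refl tsub_refl// maxxx. Qed.

Lemma dE_triangle (R : realType) (x y z : {nonneg \bar R}) :
  dE_fun x z <= dE_fun x y + dE_fun y z.
Proof.
rewrite /dE_fun ge_max; apply/andP; split.
  apply: (@le_trans _ _ (dP_fun x y + dP_fun y z)).
    exact: tsub_triangle.
  by apply: leeD; rewrite le_max lexx.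
apply: (le_trans (dPm_triangle x y z)).
by apply: leeD; rewrite le_max lexx orbT.
Qed.

Definition dE (R : realType) : qmetric R {nonneg \bar R} :=
  QMetric (@dE_ge0 R) (@dE_refl R) (@dE_triangle R).

Definition deltaP_fun (R : realType) (x : {nonneg \bar R})
    (A : set {nonneg \bar R}) : \bar R :=
  if A == set0 then +oo
  else tsub x%:num (ereal_sup [set a%:num | a in A]).

Lemma deltaP_nonempty (R : realType) (x : {nonneg \bar R})
    (A : set {nonneg \bar R}) :
  A !=set0 -> deltaP_fun x A = tsub x%:num (ereal_sup [set a%:num | a in A]).
Proof. by move=> /set0P A0; rewrite /deltaP_fun ifF//; exact/negbTE. Qed.

Lemma ereal_sup_nng_ge0 (R : realType) (A : set {nonneg \bar R}) :
  A !=set0 -> 0 <= ereal_sup [set a%:num | a in A].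
Proof.
move=> [a Aa]; apply: (@le_trans _ _ a%:num) => //.
by apply: ereal_sup_ubound; exists a.
Qed.

Lemma deltaP_ge0 (R : realType) (x : {nonneg \bar R})
    (A : set {nonneg \bar R}) :
  0 <= deltaP_fun x A.
Proof. by rewrite /deltaP_fun; case: ifP => _//; exact: tsub_ge0. Qed.

Lemma deltaP_set1 (R : realType) (x : {nonneg \bar R}) :
  deltaP_fun x [set x] = 0.
Proof.
rewrite deltaP_nonempty; last by exists x.
by rewrite image_set1 ereal_sup1 tsub_refl.
Qed.

Lemma deltaP_set0 (R : realType) (x : {nonneg \bar R}) :
  deltaP_fun x set0 = +oo.
Proof. by rewrite /deltaP_fun eqxx. Qed.

Lemma deltaP_setU (R : realType) (x : {nonneg \bar R})
    (A B : set {nonneg \bar R}) :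
  deltaP_fun x (A `|` B) = mine (deltaP_fun x A) (deltaP_fun x B).
Proof.
have [->|/set0P A0] := eqVneq A set0.
  by rewrite set0U deltaP_set0 minye.
have [->|/set0P B0] := eqVneq B set0.
  by rewrite setU0 deltaP_set0 miney.
have AB0 : A `|` B !=set0 by case: A0 => a ?; exists a; left.
have sA := ereal_sup_nng_ge0 A0; have sB := ereal_sup_nng_ge0 B0.
rewrite !deltaP_nonempty//.
rewrite image_setU.
have -> (S T : set (\bar R)) :
    ereal_sup (S `|` T) = maxe (ereal_sup S) (ereal_sup T).
  apply/eqP; rewrite eq_le ge_max; apply/andP; split.
    apply: ge_ereal_sup => y [Sy|Ty]; rewrite le_max.
      by rewrite ereal_sup_ubound.
    by rewrite (ereal_sup_ubound Ty) orbT.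
  by apply/andP; split; apply: ereal_sup_le => y; [left|right].
have tsubS (a b : \bar R) : 0 <= a -> a <= b -> tsub x%:num b <= tsub x%:num a.
  move=> a0 ab; have b0 := le_trans a0 ab; rewrite tsub_le ?tsub_ge0//.
  by rewrite (le_trans (le_tsub _ a0))// leeD2r.
case: (leP (ereal_sup [set a%:num | a in A])) => [AB|/ltW BA].
  by apply/esym/min_idPr; exact: tsubS.
by apply/esym/min_idPl; exact: tsubS.
Qed.

Lemma deltaP_enlarge (R : realType) (x : {nonneg \bar R})
    (A : set {nonneg \bar R}) (e : \bar R) : 0 <= e ->
  deltaP_fun x A <= deltaP_fun x [set y | deltaP_fun y A <= e] + e.
Proof.
case: e => [r r0|_|//]; last by rewrite ge0_addey ?leey// ?deltaP_ge0.
have [->|/set0P A0] := eqVneq A set0.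
  rewrite [X in deltaP_fun _ X + _](_ : _ = set0) ?deltaP_set0//.
  by apply/seteqP; split=> y //=; rewrite deltaP_set0 leye_eq.
have sA := ereal_sup_nng_ge0 A0.
set Ae := [set y | _].
have Ae0 : Ae !=set0.
  case: A0 => a Aa; exists a; rewrite /Ae /= deltaP_nonempty; last by exists a.
  rewrite tsub_le//; apply: (@le_trans _ _ (ereal_sup [set b%:num | b in A])).
    by apply: ereal_sup_ubound; exists a.
  by rewrite leeDl.
have sAe := ereal_sup_nng_ge0 Ae0.
rewrite !deltaP_nonempty//.
rewrite tsub_le ?adde_ge0 ?tsub_ge0//.
rewrite (le_trans (le_tsub _ sAe))// [leRHS]addeCA [leLHS]addeC leeD2l//.
apply: ge_ereal_sup => _ [y + <-]; rewrite /Ae /= deltaP_nonempty//.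
by rewrite tsub_le.
Qed.

Definition deltaP (R : realType) : distance R {nonneg \bar R} :=
  Distance (@deltaP_ge0 R) (@deltaP_set1 R) (@deltaP_set0 R)
    (@deltaP_setU R) (@deltaP_enlarge R).

(** ** Regular functions and interpolation *)

Definition nng_bounded (R : realType) (X : Type)
    (f : X -> {nonneg \bar R}) : Prop :=
  exists M : R, forall x, (f x)%:num <= M%:E.

Definition lower_regular (R : realType) (X : Type) (delta : distance R X)
    (f : X -> {nonneg \bar R}) : Prop :=
  approach_contraction delta (deltaP R) f.

Definition upper_regular (R : realType) (X : Type) (delta : distance R X)
    (f : X -> {nonneg \bar R}) : Prop :=
  nng_bounded f /\ approach_contraction delta (qmet_dist (dPm R)) f.

Definition approach_Katetov_Tong (R : realType) (X : Type)
    (delta : distance R X) : Prop :=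
  forall g h : X -> {nonneg \bar R},
    nng_bounded g -> nng_bounded h ->
    (forall x, (g x)%:num <= (h x)%:num) ->
    upper_regular delta g -> lower_regular delta h ->
    exists f : X -> {nonneg \bar R},
      approach_contraction delta (qmet_dist (dE R)) f /\
      forall x, (g x)%:num <= (f x)%:num <= (h x)%:num.

(** Mirror image of the library's [lower_semicontinuous]. *)
Definition upper_semicontinuous (R : realType) (X : topologicalType)
    (f : X -> \bar R) : Prop :=
  forall x a, f x < a%:E ->
    exists2 V, nbhs x V & forall y, V y -> f y < a%:E.

(** Functions into [0, +oo[ are represented by nonnegative functions into R:
    continuity into the subspace [0, +oo[ is continuity into R. *)
Definition topological_Katetov_Tong (R : realType) (X : topologicalType) :
    Prop :=
  forall g h : X -> R,
    (forall x, (0 <= g x)%R) -> (forall x, (0 <= h x)%R) ->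
    bounded_fun g -> bounded_fun h ->
    (forall x, (g x <= h x)%R) ->
    upper_semicontinuous (EFin \o g) -> lower_semicontinuous (EFin \o h) ->
    exists f : X -> R,
      [/\ forall x, (0 <= f x)%R, continuous f &
          forall x, (g x <= f x <= h x)%R].

(* Main.v *)
Require Import Defs.
From mathcomp Require Import all_boot all_order all_algebra.
From mathcomp Require Import all_classical all_reals all_analysis.

(** The distance of a topology takes only the values 0 and +oo, so a map out
    of (X, top_dist) is a contraction exactly when the distance from its value
    at x to the image of A vanishes for every x in the closure of A. Hence
    being a contraction is a purely topological condition, and for finite-valued
    functions the three target distances on [0, +oo] turn it into three familiar
    ones.

    For the distance of a quasi-metric d the condition says that
    d (f x) (f y) < e for y near x ([contraction_top_qmetP]). For [dPm], whose
    value at (f x, f y) is the excess of f y over f x, this is upper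
    semicontinuity ([upper_regular_topP]); for [dE] it is continuity
    ([contraction_top_dEP]). For [deltaP] it says that f x is at most the
    supremum of f over every set whose closure contains x, which is lower semicontinuity
    ([lower_regular_topP]).

    All functions in the two interpolation statements are bounded, hence
    finite, and correspond to nonnegative real-valued functions. The
    interpolating function is finite as well because it lies below h. The
    equivalence is therefore a translation of each statement into the other. *)

Import Order.TTheory GRing.Theory Num.Theory.
Import numFieldNormedType.Exports.

Set Implicit Arguments.
Unset Strict Implicit.
Unset Printing Implicit Defensive.

Local Open Scope classical_set_scope.
Local Open Scope ring_scope.
Local Open Scope ereal_scope.

Lemma contraction_topP (R : realType) (X : topologicalType) (Y : Type)
    (dY : distance R Y) (F : X -> Y) :
  approach_contraction (top_dist R X) dY F <->
  forall x A, closure A x -> dY (F x) (F @` A) <= 0.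
Proof.
split=> [cF x A xA|cF x A].
  by have := cF x A; rewrite /= /top_dist_fun mem_set.
by rewrite /= /top_dist_fun; case: ifPn => [/set_mem/cF//|_]; rewrite leey.
Qed.

(** If x were adherent to the set where d (F x) (F y) is at least e, the image
    of that set would be at distance at least e from F x, not 0; conversely every
    neighbourhood of an adherent point x of A meets A, so the infimum defining
    the distance from F x to F(A) is smaller than every e > 0. *)
Lemma contraction_top_qmetP (R : realType) (X : topologicalType) (Y : Type)
    (d : qmetric R Y) (F : X -> Y) :
  approach_contraction (top_dist R X) (qmet_dist d) F <->
  forall x (e : R), (0 < e)%R -> \forall y \near x, d (F x) (F y) < e%:E.
Proof.
rewrite contraction_topP; split=> [cF x e e0|cF x A xA].
  (* B is a neighbourhood of x that misses the set. *)
  have /existsNP[B /not_implyP[xB /set0P/negP/negPn/eqP B0]] :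
      ~ closure [set y | e%:E <= d (F x) (F y)] x.
    move=> /cF; apply/negP; rewrite -ltNge.
    apply: (@lt_le_trans _ _ e%:E); first by rewrite lte_fin.
    by apply: le_ereal_inf_tmp => _ [_ [y ey <-] <-].
  apply: filterS xB => y By; rewrite ltNge; apply/negP => ey.
  by have : set0 y by rewrite -B0.
apply/lee_addgt0Pr => e e0; rewrite add0e.
have [y [Ay ye]] := xA _ (cF x e e0).
by apply/(le_trans _ (ltW ye))/ereal_inf_lbound; exists (F y) => //; exists y.
Qed.

Lemma tsub_finE (R : realType) (a b : R) :
  tsub a%:E b%:E = (Num.max (a - b) 0)%:E.
Proof. by rewrite /tsub -EFinB EFin_max. Qed.

Section FiniteValues.
Variables (R : realType) (X : topologicalType).
Variables (F : X -> {nonneg \bar R}) (f : X -> R).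
Hypothesis Ff : forall x, (F x)%:num = (f x)%:E.

Lemma nng_boundedP : nng_bounded F <-> bounded_fun f.
Proof.
have f0 x : (0 <= f x)%R.
  have : 0 <= (F x)%:num by [].
  by rewrite Ff lee_fin.
split=> [[M FM]|[M [_ fM]]].
  exists M; split; first exact: num_real.
  move=> N MN x _ /=; rewrite ger0_norm//; apply: le_trans (ltW MN).
  by rewrite -lee_fin -Ff.
exists (M + 1)%R => x; rewrite Ff lee_fin -[leLHS]ger0_norm//.
by apply: fM => //; rewrite ltrDl.
Qed.

Lemma upper_regular_topP : nng_bounded F ->
  upper_regular (top_dist R X) F <-> upper_semicontinuous (EFin \o f).
Proof.
move=> bF; split=> [[_ /contraction_top_qmetP cF] x a|uf].
  rewrite /= lte_fin => fxa; exists [set y | (f y < a)%R].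
    have := cF x (a - f x)%R; rewrite subr_gt0 => /(_ fxa).
    apply: filterS => y /=; rewrite /dPm_fun !Ff tsub_finE lte_fin gt_max.
    by rewrite ltrD2r => /andP[].
  by move=> y /=; rewrite lte_fin.
split=> //; apply/contraction_top_qmetP => x e e0.
have [|V xV Vf] := uf x (f x + e)%R; first by rewrite lte_fin ltrDl.
apply: filterS xV => y /Vf; rewrite /= /dPm_fun !Ff tsub_finE !lte_fin.
by rewrite gt_max ltrBlDl e0 andbT.
Qed.

(** Here the distance is not given by a quasi-metric, but the argument is the
    same: F x <= a as soon as x is adherent to the sublevel set [F <= a]. *)
Lemma lower_regular_topP :
  lower_regular (top_dist R X) F <-> lower_semicontinuous (EFin \o f).
Proof.
rewrite /lower_regular contraction_topP; split=> [cF x a|lf x A xA].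
  rewrite /= lte_fin => fxa.
  have /existsNP[B /not_implyP[xB /set0P/negP/negPn/eqP B0]] :
      ~ closure [set y | (f y <= a)%R] x.
    move=> xA; have [y0 [/= fy0 _]] := xA _ filterT.
    have A0 : F @` [set y | (f y <= a)%R] !=set0 by exists (F y0), y0.
    have := cF _ _ xA; rewrite /= deltaP_nonempty// tsub_le// ?adde0; last first.
      exact: ereal_sup_nng_ge0.
    apply/negP; rewrite -ltNge Ff; apply: le_lt_trans (_ : a%:E < _).
      by apply: ge_ereal_sup => _ [_ [y /= fya <-] <-]; rewrite Ff lee_fin.
    by rewrite lte_fin.
  exists B => // y By /=; rewrite lte_fin ltNge; apply/negP => fya.
  by have : set0 y by rewrite -B0.
have [y0 [/= Ay0 _]] := xA _ filterT.
have A0 : F @` A !=set0 by exists (F y0), y0.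
rewrite /= deltaP_nonempty// tsub_le// ?adde0; last exact: ereal_sup_nng_ge0.
rewrite leNgt Ff; apply/negP.
(* The supremum is at least 0 and less than F x, hence a real number s, to
   which semicontinuity applies. *)
have: 0 <= ereal_sup [set a%:num | a in F @` A] by exact: ereal_sup_nng_ge0.
case sE : ereal_sup => [s| |]// _ /(lf x)[V xV Vf].
have [y [Ay /Vf]] := xA V xV; apply/negP; rewrite -leNgt -sE /= -Ff.
by apply: ereal_sup_ubound; exists (F y) => //; exists y.
Qed.

Lemma contraction_top_dEP :
  approach_contraction (top_dist R X) (qmet_dist (dE R)) F <-> continuous f.
Proof.
have dEE x y : dE R (F x) (F y) = `|f x - f y|%:E.
  rewrite /= /dE_fun /dP_fun /dPm_fun !Ff !tsub_finE -EFin_max; congr _%:E.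
  rewrite -(opprB (f x)); have /orP[s0|s0] := @le_total _ R 0%R (f x - f y)%R.
    by rewrite ger0_norm// (max_l s0) (@max_r _ _ (- _)%R) ?oppr_le0 ?max_l.
  by rewrite ler0_norm// (max_r s0) (@max_l _ _ (- _)%R) ?max_r ?oppr_ge0.
rewrite contraction_top_qmetP; split=> cF x.
  apply/cvgrPdist_lt => e e0; apply: filterS (cF x e e0) => y.
  by rewrite dEE lte_fin.
move=> e e0; have /cvgrPdist_lt/(_ _ e0) := cF x.
by apply: filterS => y; rewrite dEE lte_fin.
Qed.

End FiniteValues.

Lemma exists_nng_lift (R : realType) (X : Type) (f : X -> R) :
  (forall x, (0 <= f x)%R) ->
  exists F : X -> {nonneg \bar R}, forall x, (F x)%:num = (f x)%:E.
Proof. by move=> f0; exists (fun x => (NngNum (f0 x))%:num%:E%:nng) => x. Qed.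

Lemma nng_bounded_fine (R : realType) (X : Type) (F : X -> {nonneg \bar R}) :
  nng_bounded F -> forall x, (F x)%:num = (fine (F x)%:num)%:E.
Proof.
move=> [M FM] x; rewrite fineK// ge0_fin_numE//.
by apply: le_lt_trans (FM x) _; rewrite ltry.
Qed.

Theorem proposition4p4 (R : realType) (X : topologicalType) :
  topological_Katetov_Tong R X <-> approach_Katetov_Tong (top_dist R X).
Proof.
split=> KT.
  move=> G H bG bH GH uG lH.
  have Gg := nng_bounded_fine bG; have Hh := nng_bounded_fine bH.
  have [|||||||f [f0 cf gfh]] :=
    KT (fun x => fine (G x)%:num) (fun x => fine (H x)%:num).
  - by move=> x; rewrite fine_ge0.
  - by move=> x; rewrite fine_ge0.
  - exact/(nng_boundedP Gg).
  - exact/(nng_boundedP Hh).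
  - by move=> x; rewrite -lee_fin -Gg -Hh.
  - exact/(upper_regular_topP Gg).
  - exact/(lower_regular_topP Hh).
  have [F Ff] := exists_nng_lift f0.
  exists F; split; first exact/(contraction_top_dEP Ff).
  by move=> x; rewrite Ff Gg Hh !lee_fin.
move=> g h g0 h0 bg bh gh ug lh.
have [G Gg] := exists_nng_lift g0; have [H Hh] := exists_nng_lift h0.
have bG : nng_bounded G by apply/(nng_boundedP Gg).
have bH : nng_bounded H by apply/(nng_boundedP Hh).
have [|||F [cF GFH]] := KT G H bG bH.
- by move=> x; rewrite Gg Hh lee_fin.
- exact/(upper_regular_topP Gg).
- exact/(lower_regular_topP Hh).
have bF : nng_bounded F.
  by case: bH => M HM; exists M => x; case/andP: (GFH x) => _ /le_trans; apply.
have Ff := nng_bounded_fine bF.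
exists (fun x => fine (F x)%:num); split.
- by move=> x; rewrite fine_ge0.
- exact/(contraction_top_dEP Ff).
- by move=> x; rewrite -!lee_fin -Ff -Gg -Hh.
Qed.
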